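(* Let $A$ be a unital $\ast$-algebra, let $d\in\mathbb{N}$, and let $\rho\in\mathrm{End}(A^d)$ be an idempotent left $A$-module endomorphism of the free left $A$-module $A^d$ whose matrix $\rho_\beta\in M_d(A)$ satisfies $\rho_\beta=\rho_\beta^\dagger$. Let $(-,-)_{\mathrm{L}}:\rho(A^d)\times\rho(A^d)\to A$ be the Hermitian structure induced on $\rho(A^d)=A^d\cdot\rho_\beta$ by restriction of the canonical Hermitian structure of $A^d$. Then every left $A$-module endomorphism of $\rho(A^d)$ is $A$-adjointable with respect to $(-,-)_{\mathrm{L}}$.
   Context: $\ast$-algebras are complex, associative and unital, with antilinear, antimultiplicative involution $\ast$. The canonical Hermitian structure on the free left $A$-module $A^d$ is $(\overline{x},\overline{y})^d_{\mathrm{L}}=\sum_{i=1}^d x_i\,y_i^\ast$ for $\overline{x}=(x_1,\dots,x_d)$, $\overline{y}=(y_1,\dots,y_d)$. Left $A$-module endomorphisms $C$ of $A^d$ correspond to matrices $C_\beta\in M_d(A)$ (with respect to the canonical basis $\beta$) by $C(\overline{x})=\overline{x}\cdot C_\beta$ (row vector times matrix). For a matrix $C_\beta$, $C_\beta^\dagger$ is its conjugate transpose: $(C_\beta^\dagger)_{ij}=(C_{ji})^\ast$. A left $A$-module endomorphism $C$ of a left $A$-module $M$ with Hermitian structure $(-,-):M\times M\to A$ is $A$-adjointable if there is a left $A$-module endomorphism $C^\star$ of $M$ with $(C(x),y)=(x,C^\star(y))$ for all $x,y\in M$. *)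

(* Defs.v *)
From HB Require Import structures.
From mathcomp Require Import all_boot all_order all_algebra.
From mathcomp Require Import boolp classical_sets reals.
From mathcomp Require Import complex.

Set Implicit Arguments.
Unset Strict Implicit.
Unset Printing Implicit Defensive.

Import GRing.Theory.

Local Open Scope ring_scope.
Local Open Scope classical_set_scope.

(* The scalar action is carried here, over [pzRingType], because [algType]
   requires 1 != 0, whereas the zero algebra is a legitimate unital *-algebra.
   The factory below recovers the usual presentation on an [algType]. *)
HB.mixin Record PzRing_isStarAlgebra (R : realType) A of GRing.PzRing A := {
  cscale : R[i] -> A -> A;
  cscaleA : forall (z w : R[i]) (a : A),
    cscale z (cscale w a) = cscale (z * w) a;
  cscale1 : forall a : A, cscale 1 a = a;
  cscaleDr : forall (z : R[i]) (a b : A),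
    cscale z (a + b) = cscale z a + cscale z b;
  cscaleDl : forall (z w : R[i]) (a : A),
    cscale (z + w) a = cscale z a + cscale w a;
  cscaleAl : forall (z : R[i]) (a b : A), cscale z (a * b) = cscale z a * b;
  cscaleAr : forall (z : R[i]) (a b : A), cscale z (a * b) = a * cscale z b;
  star : A -> A;
  starD : forall a b : A, star (a + b) = star a + star b;
  starZ : forall (z : R[i]) (a : A),
    star (cscale z a) = cscale (conjc z) (star a);
  starM : forall a b : A, star (a * b) = star b * star a;
  starK : forall a : A, star (star a) = a
}.

#[short(type="starAlgType")]
HB.structure Definition StarAlgebra (R : realType) :=
  {A of GRing.PzRing A & PzRing_isStarAlgebra R A}.

HB.factory Record Algebra_isStarAlgebra (R : realType) A
    of GRing.Algebra R[i] A := {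
  star : A -> A;
  starD : forall a b : A, star (a + b) = star a + star b;
  starZ : forall (z : R[i]) (a : A), star (z *: a) = conjc z *: star a;
  starM : forall a b : A, star (a * b) = star b * star a;
  starK : forall a : A, star (star a) = a
}.

HB.builders Context (R : realType) A of Algebra_isStarAlgebra R A.

HB.instance Definition _ := PzRing_isStarAlgebra.Build R A
  (@scalerA _ A) (@scale1r _ A) (@scalerDr _ A)
  (fun z w a => scalerDl a z w) (@scalerAl _ A) (@scalerAr _ A)
  starD starZ starM starK.

HB.end.

Section Image.
Context {K : pzRingType} {U V : lmodType K} (f : {linear U -> V}).

Definition image_mod : Type := {y : V | y \in range f}.

HB.instance Definition _ := SubType.on image_mod.
HB.instance Definition _ := Choice.on image_mod.

Fact image_mod_closed :
  GRing.subsemimod_closed [pred y : V | y \in range f].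
Proof.
split=> [|a v]; last first.
  rewrite !inE => -[x _ <-].
  by exists (a *: x); rewrite ?linearZ.
split=> [|u v]; first by rewrite inE; exists 0; rewrite ?linear0.
rewrite !inE => -[x _ <-] [y _ <-].
by exists (x + y); rewrite ?linearD.
Qed.

HB.instance Definition _ :=
  GRing.SubChoice_isSubLmodule.Build K V _ image_mod image_mod_closed.

End Image.
Arguments image_mod {K U V} f.

Section Hermitian.
Context {R : realType} {A : starAlgType R} {d : nat}.

(* The matrix M of an endomorphism f of A^d, with f x = x *m M, is [lin1_mx f]
   (see [mul_rV_lin1]); left A-linearity suits row vectors, so A need not be
   commutative. *)
Definition dagger (M : 'M[A]_d) : 'M[A]_d := \matrix_(i, j) star (M j i).

Definition herm (x y : 'rV[A]_d) : A := \sum_(i < d) x 0 i * star (y 0 i).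

Definition herm_image (rho : {linear 'rV[A]_d -> 'rV[A]_d})
  (x y : image_mod rho) : A := herm (\val x) (\val y).

End Hermitian.

Definition adjointable {R : realType} {A : starAlgType R} {M : lmodType A}
    (form : M -> M -> A) (C : {linear M -> M}) : Prop :=
  exists Cstar : {linear M -> M},
    forall x y : M, form (C x) y = form x (Cstar y).

(* Main.v *)
Require Import Defs.
From mathcomp Require Import all_boot all_order all_algebra reals.
From mathcomp Require Import classical_sets.
From HB Require Import structures.

(** Since rho is idempotent, corestricting it gives a retraction of A^d onto
    the image P of rho, so an endomorphism C of P lifts to the endomorphism
    x |-> C (rho x) of the free module A^d ([image_lift]).  That lift is right
    multiplication by a matrix M, and every such map has an adjoint for the
    canonical form, namely right multiplication by the conjugate transpose of M
    ([herm_mulmx]).  This adjoint need not preserve P, but compressing it back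
    to P by the retraction keeps it adjoint to C: the first argument lies in P,
    hence is fixed by rho, and rho can be moved across the form because its
    matrix is self-adjoint ([herm_selfadjoint]). *)

Import GRing.Theory.

Local Open Scope ring_scope.

(** * Matrix adjoints for the canonical Hermitian form *)

Section CanonicalForm.
Context {R : realType} {A : starAlgType R} {d : nat}.
Implicit Types (x y : 'rV[A]_d) (M : 'M[A]_d).

Lemma star_sum (I : finType) (F : I -> A) :
  star (\sum_i F i) = \sum_i star (F i).
Proof.
have star0 : star (0 : A) = 0.
  by apply: (addIr (star (0 : A))); rewrite -starD !add0r.
exact: (big_morph star starD star0).
Qed.

(** Both sides are the double sum of x_i M_ij y_j^*, because the involution
    reverses the products y_j M_ij^* and undoes the star put by [dagger]. *)
Lemma herm_mulmx M x y : herm (x *m M) y = herm x (y *m dagger M).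
Proof.
rewrite /herm.
under eq_bigr do rewrite mxE mulr_suml.
rewrite exchange_big; apply: eq_bigr => i _.
rewrite mxE star_sum mulr_sumr; apply: eq_bigr => j _.
by rewrite mxE starM starK mulrA.
Qed.

Lemma herm_selfadjoint (f : {linear 'rV[A]_d -> 'rV[A]_d}) :
  lin1_mx f = dagger (lin1_mx f) ->
  forall x y, herm (f x) y = herm x (f y).
Proof.
by move=> f_sa x y; rewrite -!(mul_rV_lin1 f) herm_mulmx -f_sa.
Qed.

End CanonicalForm.

(** * Corestriction to the image and lifting of endomorphisms *)

Section Corestriction.
Context {K : pzRingType} {U V : lmodType K} (f : {linear U -> V}).

Fact mem_range (x : U) : f x \in range f.
Proof. by rewrite inE; exists x. Qed.

Definition corestr (x : U) : image_mod f := Sub (f x) (mem_range x).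

Lemma val_corestr x : \val (corestr x) = f x.
Proof. exact: SubK. Qed.

Fact corestr_is_linear : linear corestr.
Proof.
by move=> a x y; apply: val_inj; rewrite linearP !val_corestr linearP.
Qed.

HB.instance Definition _ := GRing.isLinear.Build K U (image_mod f) *:%R
  corestr corestr_is_linear.

End Corestriction.

Section Retraction.
Context {K : pzRingType} {V : lmodType K} (f : {linear V -> V}).
Hypothesis f_idem : forall x, f (f x) = f x.

Lemma idem_image_val (x : image_mod f) : f (\val x) = \val x.
Proof. by have := valP x; rewrite inE => -[z _ <-]; exact: f_idem. Qed.

Lemma corestrK (x : image_mod f) : corestr f (\val x) = x.
Proof. by apply: val_inj; rewrite val_corestr idem_image_val. Qed.

End Retraction.

(** Endomorphisms of the image are in this way given by matrices when V is
    free, although the image itself need not have a basis. *)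
Definition image_lift {K : pzRingType} {V : lmodType K} (f : {linear V -> V})
    (C : {linear image_mod f -> image_mod f}) : {linear V -> V} :=
  \val \o (C \o corestr f).

(** * Adjointability on the image of a projection *)

Theorem proposition6p1 (R : realType) (A : starAlgType R) (d : nat)
    (rho : {linear 'rV[A]_d -> 'rV[A]_d})
    (rho_idem : forall x, rho (rho x) = rho x)
    (rho_sa : lin1_mx rho = dagger (lin1_mx rho))
    (C : {linear image_mod rho -> image_mod rho}) :
  adjointable (@herm_image R A d rho) C.
Proof.
pose M := lin1_mx (image_lift rho C).
pose Cstar : {linear image_mod rho -> image_mod rho} :=
  corestr rho \o (mulmxr (dagger M) \o \val).
exists Cstar => x y; rewrite /herm_image val_corestr /=.
have -> : \val (C x) = \val x *m M.
  by rewrite mul_rV_lin1 /= corestrK.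
by rewrite herm_mulmx -herm_selfadjoint // idem_image_val.
Qed.
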